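(* Let $h>0$ and $\lambda<0$. The general solution of the difference inequality $$y(t+h)-\lambda y(t)\ge 0$$ is given by $$y(t)=|\lambda|^{t/h}\mu(t)+\sum_{s=1}^{\lfloor t\rfloor_h}\lambda^{s-1}p(t-sh),$$ where $p$ is any non-negative real-valued function and $\mu\in\mathbb{AP}_h$.
   Context: Functions are real-valued functions of a real variable. $\mathbb{AP}_h$ denotes the set of all functions $\mu:\mathbb{R}\to\mathbb{R}$ with $\mu(x+h)=-\mu(x)$ (antiperiodic functions with antiperiod $h$). For $h>0$, $\lfloor t\rfloor_h\in\mathbb{Z}$ is defined by $\lfloor t\rfloor_h=n$ where $t=nh+r$, $n\in\mathbb{Z}$, $0\le r<h$; equivalently $\lfloor t\rfloor_h=\lfloor t/h\rfloor$. A sum whose upper limit is smaller than its lower limit equals $0$.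
   Formalization: That every solution has the given form is proved only for t ≥ 0; for t < 0 the sums are empty, so the formula forces y(t+h) − λy(t) = 0, and the solution y = 1 is not of this form on all of ℝ. That the formula solves the inequality is proved for all real t. *)

(* Defs.v *)
From Stdlib Require Import Reals ZArith.
From Coquelicot Require Import Coquelicot.
Open Scope R_scope.

Definition antiperiodic (h : R) (mu : R -> R) : Prop :=
  forall x : R, mu (x + h) = - mu x.

Definition floor_h (h t : R) : Z := Int_part (t / h).

(* Sum over s = 1, ..., n for an integer n.  [Z.to_nat] sends a negative n to 0,
   and [sum_n_m f 1 0] is 0, so the sum is 0 whenever n < 1. *)
Definition sum_from_1 (n : Z) (f : nat -> R) : R := sum_n_m f 1 (Z.to_nat n).

Definition solution_formula (h lam : R) (mu p : R -> R) (t : R) : R :=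
  Rpower (Rabs lam) (t / h) * mu t
  + sum_from_1 (floor_h h t) (fun s : nat => lam ^ (s - 1) * p (t - INR s * h)).

Definition solves_at (h lam : R) (y : R -> R) (t : R) : Prop :=
  y (t + h) - lam * y t >= 0.

(* Main.v *)
(* The formula [F] satisfies F(t+h) = lam F(t) + p(t) for t >= 0 and
   F(t+h) = lam F(t) for t < 0.  Conversely, given a solution y, take p to be the
   defect y(t+h) - lam y(t), and mu the antiperiodic function for which F and y
   agree on [0, h); the common recurrence then carries the agreement from
   [nh, (n+1)h) to [(n+1)h, (n+2)h). *)
Require Import Defs.
From Stdlib Require Import Reals ZArith Lra Lia.
From Coquelicot Require Import Coquelicot.
Open Scope R_scope.

Lemma floor_h_bounds (h t : R) : 0 < h ->
  IZR (floor_h h t) * h <= t < (IZR (floor_h h t) + 1) * h.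
Proof.
intros hh; unfold floor_h.
destruct (base_Int_part (t / h)) as [H1 H2].
replace t with (t / h * h) at 2 3 by (field; lra).
split.
- apply Rmult_le_compat_r; lra.
- apply Rmult_lt_compat_r; lra.
Qed.

Lemma floor_h_shift (h t : R) : 0 < h -> floor_h h (t + h) = (floor_h h t + 1)%Z.
Proof.
intros hh; unfold floor_h; symmetry; apply Int_part_spec.
destruct (base_Int_part (t / h)) as [H1 H2].
rewrite plus_IZR.
replace ((t + h) / h) with (t / h + 1) by (field; lra).
lra.
Qed.

Lemma floor_h_ge0 (h t : R) : 0 < h -> 0 <= t -> (0 <= floor_h h t)%Z.
Proof.
intros hh ht.
destruct (floor_h_bounds h t hh) as [_ H].
assert (-1 < IZR (floor_h h t)) by nra.
apply Z.lt_pred_le, lt_IZR; exact H0.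
Qed.

Lemma floor_h_lt0 (h t : R) : 0 < h -> t < 0 -> (floor_h h t < 0)%Z.
Proof.
intros hh ht.
destruct (floor_h_bounds h t hh) as [H _].
apply lt_IZR; nra.
Qed.

Lemma sum_from_1_nonpos (n : Z) (f : nat -> R) : (n <= 0)%Z -> sum_from_1 n f = 0.
Proof.
intros hn; unfold sum_from_1.
replace (Z.to_nat n) with 0%nat by lia.
now apply (@sum_n_m_zero R_AbelianMonoid); lia.
Qed.

(** Split off the term s = 1, whose exponent is 0, then reindex the rest and pull one factor [lam]
    out. *)
Lemma sum_from_1_shift (n : Z) (lam : R) (g : nat -> R) : (0 <= n)%Z ->
  sum_from_1 (n + 1) (fun s => lam ^ (s - 1) * g s)
  = g 1%nat + lam * sum_from_1 n (fun s => lam ^ (s - 1) * g (S s)).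
Proof.
intros hn; unfold sum_from_1.
replace (Z.to_nat (n + 1)) with (S (Z.to_nat n)) by lia.
rewrite sum_Sn_m by lia.
rewrite <- sum_n_m_S.
change (@plus R_AbelianMonoid) with Rplus.
change (lam ^ (1 - 1)) with 1; rewrite Rmult_1_l; f_equal.
change (lam * ?x) with (@mult R_Ring lam x).
rewrite <- (@sum_n_m_mult_l R_Ring).
(* The bound 1 <= k is used: with truncated subtraction, S k - 1 = S (k - 1) fails at k = 0. *)
apply sum_n_m_ext_loc; intros k hk.
change (@mult R_Ring) with Rmult.
replace (S k - 1)%nat with (S (k - 1)) by lia.
simpl; ring.
Qed.

(** The power gains a factor |lam| = -lam, and the sign change of [mu] turns it into [lam]. *)
Lemma homogeneous_shift (h lam t : R) (mu : R -> R) :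
  0 < h -> lam < 0 -> antiperiodic h mu ->
  Rpower (Rabs lam) ((t + h) / h) * mu (t + h)
  = lam * (Rpower (Rabs lam) (t / h) * mu t).
Proof.
intros hh hl hmu.
rewrite hmu.
replace ((t + h) / h) with (t / h + 1) by (field; lra).
rewrite Rpower_plus, Rpower_1, Rabs_left by (try apply Rabs_pos_lt; lra).
ring.
Qed.

(** The shift by h adds one summand: the new term s = 1 is p(t), and each old term moves up one
    index. *)
Lemma solution_formula_shift (h lam t : R) (mu p : R -> R) :
  0 < h -> lam < 0 -> antiperiodic h mu -> 0 <= t ->
  solution_formula h lam mu p (t + h) = lam * solution_formula h lam mu p t + p t.
Proof.
intros hh hl hmu ht; unfold solution_formula.
rewrite homogeneous_shift, floor_h_shift by assumption.
rewrite (sum_from_1_shift _ lam (fun s => p (t + h - INR s * h)))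
  by now apply floor_h_ge0.
replace (t + h - INR 1 * h) with t by (simpl; ring).
replace (sum_from_1 (floor_h h t)
           (fun s => lam ^ (s - 1) * p (t + h - INR (S s) * h)))
  with (sum_from_1 (floor_h h t) (fun s => lam ^ (s - 1) * p (t - INR s * h))).
- ring.
- apply sum_n_m_ext; intros s.
  rewrite S_INR; do 2 f_equal; ring.
Qed.

(** For t < 0 the floor at t + h is still at most 0, so both sums are empty. *)
Lemma solution_formula_shift_neg (h lam t : R) (mu p : R -> R) :
  0 < h -> lam < 0 -> antiperiodic h mu -> t < 0 ->
  solution_formula h lam mu p (t + h) = lam * solution_formula h lam mu p t.
Proof.
intros hh hl hmu ht; unfold solution_formula.
assert (hn := floor_h_lt0 h t hh ht).
rewrite homogeneous_shift, floor_h_shift, !sum_from_1_nonpos by (assumption || lia).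
ring.
Qed.

(** The sign is (-1)^n with n the floor of t/h; parity expresses it for negative n too. Only the
    values of [g] on [0, h) matter when h > 0. *)
Definition antiperiodic_extension (h : R) (g : R -> R) (t : R) : R :=
  (if Z.even (floor_h h t) then 1 else -1) * g (t - IZR (floor_h h t) * h).

Lemma antiperiodic_extension_antiperiodic (h : R) (g : R -> R) :
  0 < h -> antiperiodic h (antiperiodic_extension h g).
Proof.
intros hh t; unfold antiperiodic_extension.
rewrite floor_h_shift by assumption.
rewrite plus_IZR.
replace (t + h - (IZR (floor_h h t) + 1) * h)
  with (t - IZR (floor_h h t) * h) by ring.
rewrite Z.add_1_r.
rewrite Z.even_succ, <- Z.negb_even.
destruct (Z.even (floor_h h t)); simpl; ring.
Qed.

Lemma eq_of_recurrence (h lam : R) (p y z : R -> R) :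
  0 < h ->
  (forall t, 0 <= t < h -> y t = z t) ->
  (forall t, 0 <= t -> y (t + h) = lam * y t + p t) ->
  (forall t, 0 <= t -> z (t + h) = lam * z t + p t) ->
  forall t, 0 <= t -> y t = z t.
Proof.
intros hh h0 hy hz.
(* Induction on the number of periods: if t >= h, then t - h falls under the previous bound. *)
assert (H : forall n t, 0 <= t < INR (S n) * h -> y t = z t).
{ induction n as [|n IH]; intros t ht.
  - apply h0; simpl in ht; lra.
  - destruct (Rlt_or_le t h) as [lt_th | le_ht]; [apply h0; lra|].
    rewrite S_INR in ht.
    replace t with (t - h + h) by ring.
    rewrite hy, hz, IH by lra.
    reflexivity. }
intros t ht.
apply (H (Z.to_nat (floor_h h t))).
rewrite S_INR, INR_IZR_INZ, Z2Nat.id by now apply floor_h_ge0.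
split; [assumption | apply floor_h_bounds, hh].
Qed.

(** On [0, h) the sum is empty and the sign is 1; the weight with exponent -r/h cancels the power in
    the formula. *)
Lemma solution_formula_initial (h lam : R) (y p : R -> R) (t : R) :
  0 < h -> 0 <= t < h ->
  solution_formula h lam
    (antiperiodic_extension h (fun r => y r * Rpower (Rabs lam) (- (r / h)))) p t
  = y t.
Proof.
intros hh ht.
assert (h0 : floor_h h t = 0%Z).
{ destruct (floor_h_bounds h t hh) as [H _].
  assert (hn := floor_h_ge0 h t hh (proj1 ht)).
  assert (floor_h h t < 1)%Z by (apply lt_IZR; nra).
  lia. }
unfold solution_formula, antiperiodic_extension.
rewrite h0, sum_from_1_nonpos by lia; simpl Z.even; cbv iota.
replace (t - 0 * h) with t by ring.
transitivity (y t * (Rpower (Rabs lam) (t / h) * Rpower (Rabs lam) (- (t / h)))).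
- ring.
- rewrite <- Rpower_plus, Rplus_opp_r.
  unfold Rpower; rewrite Rmult_0_l, exp_0; ring.
Qed.

(* The formula solves the inequality on all of R.  Completeness is stated on the
   half-line t >= 0: for t < 0 the sum is empty, so the formula forces equality
   there, and it cannot produce e.g. the solution y = 1 on all of R. *)
Theorem theorem3p2 :
  forall (h lam : R), 0 < h -> lam < 0 ->
    (forall p mu : R -> R,
       (forall t : R, 0 <= p t) -> antiperiodic h mu ->
       forall t : R, solves_at h lam (solution_formula h lam mu p) t)
    /\
    (forall y : R -> R,
       (forall t : R, 0 <= t -> solves_at h lam y t)
       <->
       (exists p mu : R -> R,
          (forall t : R, 0 <= p t) /\ antiperiodic h mu /\
          (forall t : R, 0 <= t -> y t = solution_formula h lam mu p t))).
Proof.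
intros h lam hh hl; split.
- intros p mu hp hmu t; unfold solves_at.
  destruct (Rlt_or_le t 0) as [ht | ht].
  + rewrite solution_formula_shift_neg by assumption; lra.
  + rewrite solution_formula_shift by assumption.
    specialize (hp t); lra.
- intros y; split.
  + intros hy.
    (* For t < 0 the defect may be negative, hence the cut-off; the formula on
       t >= 0 never evaluates p there. *)
    exists (fun t => Rmax 0 (y (t + h) - lam * y t)).
    exists (antiperiodic_extension h (fun r => y r * Rpower (Rabs lam) (- (r / h)))).
    assert (hmu := antiperiodic_extension_antiperiodic h
                     (fun r => y r * Rpower (Rabs lam) (- (r / h))) hh).
    split; [intros t; apply Rmax_l|]; split; [exact hmu|].
    apply (eq_of_recurrence h lam (fun t => Rmax 0 (y (t + h) - lam * y t)));
      [assumption | | |]; intros t ht.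
    * symmetry; now apply solution_formula_initial.
    * rewrite Rmax_right by exact (Rge_le _ _ (hy t ht)); ring.
    * exact (solution_formula_shift h lam t _ _ hh hl hmu ht).
  + intros (p & mu & hp & hmu & hF) t ht; unfold solves_at.
    (* The representation is used at both t and t + h, which lie in the half-line; the defect is
       then p(t). *)
    rewrite !hF, solution_formula_shift by (assumption || lra).
    specialize (hp t); lra.
Qed.
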